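(* Let $F$ satisfy the standing assumption, let $C\subseteq X$ be nonempty, and let $T\colon C\to X$ be $F$-firmly nonexpansive. Set $A=FT^{-1}-F$, let $\Phi$ be the Fitzpatrick function of $A$, and let $$\Psi(x,x^* )=\min_{(y+z,\,y^*+z^* )=2(x,x^* )}\Big(\tfrac12\Phi(y,y^* )+\tfrac12\Phi^*(z^*,z)+\tfrac18\big(\|y-z\|^2+\|y^*-z^*\|^2\big)\Big)$$ for $(x,x^* )\in X\times X^*$. Define $\widetilde A\colon X\rightrightarrows X^*$ by $\operatorname{gra}\widetilde A=\{(x,x^* )\in X\times X^*:\Psi(x,x^* )=\langle x,x^*\rangle\}$, and set $\widetilde T=(\widetilde A+F)^{-1}F$. Then $\widetilde T$ is a single-valued map $X\to X$ which is $F$-firmly nonexpansive and extends $T$ (i.e. $\widetilde T|_C=T$).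
   Context: $X$ is a real reflexive Banach space with dual $X^*$, pairing $\langle\cdot,\cdot\rangle$, norm $\|\cdot\|$ on $X$ and dual norm on $X^*$. Standing assumption: $F\colon X\to X^*$ is single-valued with full domain, maximal monotone, strictly monotone ($\langle x-y,Fx-Fy\rangle>0$ for $x\ne y$), 3*-monotone (for every $(x,x^* )\in X\times X^*$, $\sup_{y\in X}\langle x-y,Fy-x^*\rangle<+\infty$), and surjective. $T^{-1}$ is the graph inverse. The Fitzpatrick function of $A$ is $\Phi(x,x^* )=\sup_{(y,y^* )\in\operatorname{gra}A}(\langle x,y^*\rangle+\langle y,x^*\rangle-\langle y,y^*\rangle)$; $\Phi^*\colon X^*\times X\to\left]-\infty,+\infty\right]$ is its Fenchel conjugate, $\Phi^*(z^*,z)=\sup_{(x,x^* )}(\langle x,z^*\rangle+\langle z,x^*\rangle-\Phi(x,x^* ))$. $T\colon C\to X$ is $F$-firmly nonexpansive if $\langle Tx-Ty,FTx-FTy\rangle\le\langle Tx-Ty,Fx-Fy\rangle$ for all $x,y\in C$. *)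

(* Defs.v *)
From Stdlib Require Import Reals Lra ClassicalEpsilon.
Open Scope R_scope.

Record NormedSpace := {
  car :> Type;
  vzero : car;
  vadd : car -> car -> car;
  vopp : car -> car;
  vscal : R -> car -> car;
  vnorm : car -> R;
  vadd_assoc : forall x y z, vadd x (vadd y z) = vadd (vadd x y) z;
  vadd_comm : forall x y, vadd x y = vadd y x;
  vadd_0 : forall x, vadd x vzero = x;
  vadd_opp : forall x, vadd x (vopp x) = vzero;
  vscal_1 : forall x, vscal 1 x = x;
  vscal_assoc : forall a b x, vscal a (vscal b x) = vscal (a * b) x;
  vscal_distr_l : forall a x y, vscal a (vadd x y) = vadd (vscal a x) (vscal a y);
  vscal_distr_r : forall a b x, vscal (a + b) x = vadd (vscal a x) (vscal b x);
  vnorm_eq0 : forall x, vnorm x = 0 -> x = vzero;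
  vnorm_scal : forall a x, vnorm (vscal a x) = Rabs a * vnorm x;
  vnorm_triangle : forall x y, vnorm (vadd x y) <= vnorm x + vnorm y
}.
Arguments vzero {_}. Arguments vadd {_}. Arguments vopp {_}.
Arguments vscal {_}. Arguments vnorm {_}.

Definition vsub {X : NormedSpace} (x y : X) : X := vadd x (vopp y).

Definition complete (X : NormedSpace) : Prop :=
  forall u : nat -> X,
    (forall eps, 0 < eps -> exists N, forall n m, (N <= n)%nat -> (N <= m)%nat ->
        vnorm (vsub (u n) (u m)) < eps) ->
    exists l : X, forall eps, 0 < eps -> exists N, forall n, (N <= n)%nat ->
        vnorm (vsub (u n) l) < eps.

(* real supremum (junk value if no lub exists) *)
Definition real_sup (P : R -> Prop) : R :=
  epsilon (inhabits 0) (fun s => is_lub P s).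

Definition is_linear_fun {X : NormedSpace} (f : X -> R) : Prop :=
  (forall x y, f (vadd x y) = f x + f y) /\ (forall a x, f (vscal a x) = a * f x).
Definition is_bounded_fun {X : NormedSpace} (f : X -> R) : Prop :=
  exists M, forall x, Rabs (f x) <= M * vnorm x.

Definition Dual (X : NormedSpace) : Type :=
  { f : X -> R | is_linear_fun f /\ is_bounded_fun f }.

Definition pair {X : NormedSpace} (x : X) (f : Dual X) : R := proj1_sig f x.

Lemma dadd_ok {X : NormedSpace} (f g : Dual X) :
  is_linear_fun (fun x => pair x f + pair x g) /\ is_bounded_fun (fun x => pair x f + pair x g).
Proof.
  destruct f as [f [[Hf1 Hf2] [M1 HM1]]]; destruct g as [g [[Hg1 Hg2] [M2 HM2]]];
  unfold pair; simpl. split; [split|].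
  - intros x y; rewrite Hf1, Hg1; ring.
  - intros a x; rewrite Hf2, Hg2; ring.
  - exists (M1 + M2); intros x.
    pose proof (Rabs_triang (f x) (g x)); pose proof (HM1 x); pose proof (HM2 x); nra.
Qed.

Lemma dscal_ok {X : NormedSpace} (a : R) (f : Dual X) :
  is_linear_fun (fun x => a * pair x f) /\ is_bounded_fun (fun x => a * pair x f).
Proof.
  destruct f as [f [[Hf1 Hf2] [M1 HM1]]]; unfold pair; simpl. split; [split|].
  - intros x y; rewrite Hf1; ring.
  - intros b x; rewrite Hf2; ring.
  - exists (Rabs a * M1); intros x. rewrite Rabs_mult.
    pose proof (HM1 x); pose proof (Rabs_pos a).
    rewrite Rmult_assoc; apply Rmult_le_compat_l; auto.
Qed.

Definition dadd {X : NormedSpace} (f g : Dual X) : Dual X :=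
  exist _ (fun x => pair x f + pair x g) (dadd_ok f g).
Definition dscal {X : NormedSpace} (a : R) (f : Dual X) : Dual X :=
  exist _ (fun x => a * pair x f) (dscal_ok a f).
Definition dsub {X : NormedSpace} (f g : Dual X) : Dual X := dadd f (dscal (-1) g).

Definition dnorm {X : NormedSpace} (f : Dual X) : R :=
  real_sup (fun r => exists x : X, vnorm x <= 1 /\ r = Rabs (pair x f)).

Definition reflexive (X : NormedSpace) : Prop :=
  forall phi : Dual X -> R,
    (forall f g, phi (dadd f g) = phi f + phi g) ->
    (forall a f, phi (dscal a f) = a * phi f) ->
    (exists M, forall f, Rabs (phi f) <= M * dnorm f) ->
    exists x : X, forall f, phi f = pair x f.

Inductive Rbar := Fin (r : R) | PInf | MInf.

Definition Rbar_le (a b : Rbar) : Prop :=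
  match a, b with
  | MInf, _ => True
  | _, PInf => True
  | Fin x, Fin y => x <= y
  | _, _ => False
  end.

Definition Rbar_is_lub (P : Rbar -> Prop) (s : Rbar) : Prop :=
  (forall r, P r -> Rbar_le r s) /\ (forall u, (forall r, P r -> Rbar_le r u) -> Rbar_le s u).
Definition Rbar_is_glb (P : Rbar -> Prop) (s : Rbar) : Prop :=
  (forall r, P r -> Rbar_le s r) /\ (forall u, (forall r, P r -> Rbar_le u r) -> Rbar_le u s).

Definition Rbar_sup (P : Rbar -> Prop) : Rbar := epsilon (inhabits PInf) (Rbar_is_lub P).
Definition Rbar_inf (P : Rbar -> Prop) : Rbar := epsilon (inhabits PInf) (Rbar_is_glb P).

(* convention (+oo) + (-oo) = +oo; never used in the situation of the theorem *)
Definition Rbar_plus (a b : Rbar) : Rbar :=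
  match a, b with
  | PInf, _ => PInf
  | _, PInf => PInf
  | MInf, _ => MInf
  | _, MInf => MInf
  | Fin x, Fin y => Fin (x + y)
  end.
Definition Rbar_opp (a : Rbar) : Rbar :=
  match a with Fin x => Fin (- x) | PInf => MInf | MInf => PInf end.
Definition Rbar_half (a : Rbar) : Rbar :=
  match a with Fin x => Fin (x / 2) | b => b end.

Definition SetOp (X : NormedSpace) : Type := X -> Dual X -> Prop.

Definition standing_assumption {X : NormedSpace} (F : X -> Dual X) : Prop :=
  (forall x y, 0 <= pair (vsub x y) (dsub (F x) (F y))) /\
  (* maximal monotone (single-valued, full domain) *)
  (forall x xs, (forall y, 0 <= pair (vsub x y) (dsub xs (F y))) -> xs = F x) /\
  (forall x y, x <> y -> 0 < pair (vsub x y) (dsub (F x) (F y))) /\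
  (forall (x : X) (xs : Dual X), exists M, forall y, pair (vsub x y) (dsub (F y) xs) <= M) /\
  (forall xs, exists x, F x = xs).

(* T : C -> X is F-firmly nonexpansive (T is given on all of X, only C matters) *)
Definition F_firmly_nonexpansive {X : NormedSpace} (F : X -> Dual X)
    (C : X -> Prop) (T : X -> X) : Prop :=
  forall x y, C x -> C y ->
    pair (vsub (T x) (T y)) (dsub (F (T x)) (F (T y)))
    <= pair (vsub (T x) (T y)) (dsub (F x) (F y)).

Definition op_A {X : NormedSpace} (F : X -> Dual X) (C : X -> Prop) (T : X -> X) : SetOp X :=
  fun y ys => exists x, C x /\ T x = y /\ ys = dsub (F x) (F y).

Definition Fitzpatrick {X : NormedSpace} (A : SetOp X) (x : X) (xs : Dual X) : Rbar :=
  Rbar_sup (fun r => exists y ys, A y ys /\ r = Fin (pair x ys + pair y xs - pair y ys)).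

(* Fenchel conjugate Phi^* : X^* x X -> [-oo,+oo] (using reflexivity X^** = X) *)
Definition Fenchel_conj {X : NormedSpace} (Phi : X -> Dual X -> Rbar)
    (zs : Dual X) (z : X) : Rbar :=
  Rbar_sup (fun r => exists (x : X) (xs : Dual X),
     r = Rbar_plus (Fin (pair x zs + pair z xs)) (Rbar_opp (Phi x xs))).

Definition Psi_fun {X : NormedSpace} (Phi : X -> Dual X -> Rbar) (x : X) (xs : Dual X) : Rbar :=
  Rbar_inf (fun r => exists (y z : X) (ys zs : Dual X),
     vadd y z = vscal 2 x /\ dadd ys zs = dscal 2 xs /\
     r = Rbar_plus (Rbar_plus (Rbar_half (Phi y ys)) (Rbar_half (Fenchel_conj Phi zs z)))
                   (Fin (1/8 * (vnorm (vsub y z) ^ 2 + dnorm (dsub ys zs) ^ 2)))).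

Definition op_Atilde {X : NormedSpace} (F : X -> Dual X) (C : X -> Prop) (T : X -> X) : SetOp X :=
  fun x xs => Psi_fun (Fitzpatrick (op_A F C T)) x xs = Fin (pair x xs).

Definition Ttilde_rel {X : NormedSpace} (F : X -> Dual X) (C : X -> Prop) (T : X -> X)
    (x y : X) : Prop :=
  exists a, op_Atilde F C T y a /\ F x = dadd a (F y).

(* Main.v *)
Require Import Defs.
From Stdlib Require Import Reals Lra Lia Classical ClassicalEpsilon.
From Stdlib Require Import FunctionalExtensionality ProofIrrelevance.
From mathcomp Require classical_sets.
Open Scope R_scope.

(** Both Psi and the Fitzpatrick function Phi_F of F dominate the duality pairing, so
    (u, us) lies in the graph of Atilde and w - us = F u as soon as the infimum of
    Psi(x, xs) + Phi_F(x, w - xs) - <x, w>, which is nonnegative, vanishes at (u, us).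
    Since F is 3*-monotone, Phi_F is finite everywhere, hence locally bounded by Baire, and a
    Hahn-Banach sandwich separates the two summands by an affine function; its slope is a point
    of X^* x X by reflexivity. Psi lies below its transposed conjugate, so this slope,
    transposed and with its sign changed, is the required (u, us). Hence Atilde + F is onto.
    Convexity of Psi and Psi >= <.,.> make Atilde monotone, which with the strict monotonicity
    of F gives uniqueness and firm nonexpansiveness. *)

(** * Normed spaces and their duals *)

Lemma vscal_0_l {X : NormedSpace} (x : X) : vscal 0 x = vzero.
Proof.
  assert (H : vadd (vscal 0 x) (vscal 0 x) = vscal 0 x)
    by (rewrite <- vscal_distr_r; f_equal; ring).
  rewrite <- (vadd_opp X (vscal 0 x)). rewrite <- H at 2.
  now rewrite <- vadd_assoc, vadd_opp, vadd_0.
Qed.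

Lemma vopp_scal {X : NormedSpace} (x : X) : vopp x = vscal (-1) x.
Proof.
  assert (H : vadd x (vscal (-1) x) = vzero).
  { rewrite <- (vscal_1 X x) at 1. rewrite <- vscal_distr_r.
    replace (1 + -1) with 0 by ring. apply vscal_0_l. }
  rewrite <- (vadd_0 X (vscal (-1) x)), <- (vadd_opp X x), vadd_assoc.
  rewrite (vadd_comm X (vscal (-1) x)), H.
  now rewrite vadd_comm, vadd_0.
Qed.

Lemma vnorm_zero (X : NormedSpace) : vnorm (vzero : X) = 0.
Proof. rewrite <- (vscal_0_l vzero), vnorm_scal, Rabs_R0. ring. Qed.

Lemma vnorm_opp {X : NormedSpace} (x : X) : vnorm (vopp x) = vnorm x.
Proof. rewrite vopp_scal, vnorm_scal, Rabs_left by lra. ring. Qed.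

Lemma vnorm_ge0 {X : NormedSpace} (x : X) : 0 <= vnorm x.
Proof.
  pose proof (vnorm_triangle X x (vopp x)) as H.
  rewrite vadd_opp, vnorm_zero, vnorm_opp in H. lra.
Qed.

Lemma real_sup_lub (P : R -> Prop) (M : R) :
  (exists r, P r) -> (forall r, P r -> r <= M) -> is_lub P (real_sup P).
Proof.
  intros HP HM. unfold real_sup. apply epsilon_spec.
  destruct (completeness P) as [m Hm]; [exists M; exact HM | exact HP | now exists m].
Qed.

Lemma pair_add {X : NormedSpace} (x y : X) (f : Dual X) :
  pair (vadd x y) f = pair x f + pair y f.
Proof. destruct f as [f [[H1 H2] H3]]. apply H1. Qed.

Lemma pair_scal {X : NormedSpace} a (x : X) (f : Dual X) :
  pair (vscal a x) f = a * pair x f.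
Proof. destruct f as [f [[H1 H2] H3]]. apply H2. Qed.

Lemma pair_opp {X : NormedSpace} (x : X) (f : Dual X) : pair (vopp x) f = - pair x f.
Proof. rewrite vopp_scal, pair_scal. ring. Qed.

Lemma pair_sub {X : NormedSpace} (x y : X) (f : Dual X) :
  pair (vsub x y) f = pair x f - pair y f.
Proof. unfold vsub. rewrite pair_add, pair_opp. ring. Qed.

Lemma pair_zero {X : NormedSpace} (f : Dual X) : pair vzero f = 0.
Proof. rewrite <- (vscal_0_l vzero), pair_scal. ring. Qed.

Lemma pair_dadd {X : NormedSpace} (x : X) (f g : Dual X) :
  pair x (dadd f g) = pair x f + pair x g.
Proof. reflexivity. Qed.

Lemma pair_dscal {X : NormedSpace} (x : X) a (f : Dual X) :
  pair x (dscal a f) = a * pair x f.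
Proof. reflexivity. Qed.

Lemma pair_dsub {X : NormedSpace} (x : X) (f g : Dual X) :
  pair x (dsub f g) = pair x f - pair x g.
Proof. unfold dsub. rewrite pair_dadd, pair_dscal. ring. Qed.

Ltac pairs := repeat progress rewrite ?pair_sub, ?pair_add, ?pair_opp, ?pair_scal, ?pair_zero,
  ?pair_dsub, ?pair_dadd, ?pair_dscal.
Ltac pairs_in H := repeat progress rewrite ?pair_sub, ?pair_add, ?pair_opp, ?pair_scal, ?pair_zero,
  ?pair_dsub, ?pair_dadd, ?pair_dscal in H.

Lemma dual_ext {X : NormedSpace} (f g : Dual X) :
  (forall x, pair x f = pair x g) -> f = g.
Proof.
  destruct f as [f Hf], g as [g Hg]; unfold pair; simpl; intros H.
  assert (f = g) as -> by (now apply functional_extensionality).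
  f_equal. apply proof_irrelevance.
Qed.

Lemma dnorm_lub {X : NormedSpace} (f : Dual X) :
  is_lub (fun r => exists x : X, vnorm x <= 1 /\ r = Rabs (pair x f)) (dnorm f).
Proof.
  destruct (proj2_sig f) as [_ [M HM]].
  apply (real_sup_lub _ (Rabs M)).
  - exists (Rabs (pair vzero f)), vzero. rewrite vnorm_zero. split; [lra | reflexivity].
  - intros r (x & Hx & ->). unfold pair.
    pose proof (HM x). pose proof (vnorm_ge0 x). pose proof (Rle_abs M).
    pose proof (Rabs_pos M). nra.
Qed.

Lemma dnorm_ge0 {X : NormedSpace} (f : Dual X) : 0 <= dnorm f.
Proof.
  destruct (dnorm_lub f) as [H _].
  apply Rle_trans with (Rabs (pair vzero f)); [apply Rabs_pos |].
  apply H. exists vzero. rewrite vnorm_zero. split; [lra | reflexivity].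
Qed.

Lemma pair_le {X : NormedSpace} (x : X) (f : Dual X) :
  Rabs (pair x f) <= dnorm f * vnorm x.
Proof.
  destruct (Req_dec (vnorm x) 0) as [H0 | H0].
  { rewrite (vnorm_eq0 X x H0), pair_zero, vnorm_zero, Rabs_R0. lra. }
  pose proof (vnorm_ge0 x) as Hp.
  destruct (dnorm_lub f) as [H _].
  assert (Hi : 0 < / vnorm x) by (apply Rinv_0_lt_compat; lra).
  assert (H1 : Rabs (pair (vscal (/ vnorm x) x) f) <= dnorm f).
  { apply H. eexists; split; [| reflexivity].
    rewrite vnorm_scal, Rabs_right by lra. rewrite Rinv_l; lra. }
  rewrite pair_scal, Rabs_mult, (Rabs_right (/ vnorm x)) in H1 by lra.
  apply (Rmult_le_compat_l (vnorm x)) in H1; [| lra].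
  rewrite <- Rmult_assoc, Rinv_r in H1 by lra. lra.
Qed.

Lemma dnorm_le {X : NormedSpace} (f : Dual X) M :
  0 <= M -> (forall x, Rabs (pair x f) <= M * vnorm x) -> dnorm f <= M.
Proof.
  intros HM H. apply (proj2 (dnorm_lub f)). intros r (x & Hx & ->).
  pose proof (H x). nra.
Qed.

Definition dzero (X : NormedSpace) : Dual X.
Proof.
  exists (fun _ => 0). split; [split; intros; ring |].
  exists 0. intros x. rewrite Rabs_R0. lra.
Defined.

Lemma dnorm_scal {X : NormedSpace} a (f : Dual X) : dnorm (dscal a f) = Rabs a * dnorm f.
Proof.
  assert (L : forall b (g : Dual X), dnorm (dscal b g) <= Rabs b * dnorm g).
  { intros b g. pose proof (Rabs_pos b). pose proof (dnorm_ge0 g).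
    apply dnorm_le; [nra |]. intros x. rewrite pair_dscal, Rabs_mult.
    pose proof (pair_le x g). nra. }
  apply Rle_antisym; [apply L |].
  destruct (Req_dec a 0) as [-> | Ha].
  { rewrite Rabs_R0, Rmult_0_l. apply dnorm_ge0. }
  pose proof (L (/ a) (dscal a f)) as H.
  replace (dscal (/ a) (dscal a f)) with f in H
    by (apply dual_ext; intros x; rewrite !pair_dscal; field; exact Ha).
  rewrite Rabs_inv in H. pose proof (Rabs_pos_lt a Ha).
  apply (Rmult_le_compat_l (Rabs a)) in H; [| lra].
  rewrite <- Rmult_assoc, Rinv_r in H by lra. lra.
Qed.

(** Closed with [Defined] so that its addition, scaling and norm still reduce to [dadd], [dscal] and
    [dnorm]. *)
Definition dual_space (X : NormedSpace) : NormedSpace.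
Proof.
  refine {| car := Dual X; vzero := dzero X; vadd := dadd; vopp := dscal (-1);
            vscal := dscal; vnorm := dnorm |}.
  - intros x y z. apply dual_ext; intros v. pairs. ring.
  - intros x y. apply dual_ext; intros v. pairs. ring.
  - intros x. apply dual_ext; intros v. pairs. unfold pair at 2; simpl. ring.
  - intros x. apply dual_ext; intros v. pairs. unfold pair at 3; simpl. ring.
  - intros x. apply dual_ext; intros v. pairs. ring.
  - intros a b x. apply dual_ext; intros v. rewrite !pair_dscal. ring.
  - intros a x y. apply dual_ext; intros v.
    rewrite pair_dadd, !pair_dscal, pair_dadd. ring.
  - intros a b x. apply dual_ext; intros v.
    rewrite pair_dadd, !pair_dscal. ring.
  - intros f Hf. apply dual_ext; intros v. pose proof (pair_le v f) as H.
    rewrite Hf, Rmult_0_l in H. unfold pair at 2; simpl.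
    pose proof (Rabs_pos (pair v f)). destruct (Req_dec (pair v f) 0); [assumption |].
    pose proof (Rabs_pos_lt _ H1). lra.
  - intros a f. apply dnorm_scal.
  - intros f g. apply dnorm_le.
    + pose proof (dnorm_ge0 f). pose proof (dnorm_ge0 g). lra.
    + intros v. pairs. pose proof (Rabs_triang (pair v f) (pair v g)).
      pose proof (pair_le v f). pose proof (pair_le v g). lra.
Defined.

Definition prod_space (X Y : NormedSpace) : NormedSpace.
Proof.
  refine {| car := (X * Y)%type; vzero := (vzero, vzero);
            vadd := fun p q => (vadd (fst p) (fst q), vadd (snd p) (snd q));
            vopp := fun p => (vopp (fst p), vopp (snd p));
            vscal := fun a p => (vscal a (fst p), vscal a (snd p));
            vnorm := fun p => vnorm (fst p) + vnorm (snd p) |}.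
  - intros x y z; simpl. now rewrite !vadd_assoc.
  - intros x y; simpl. now rewrite (vadd_comm X (fst x)), (vadd_comm Y (snd x)).
  - intros [x y]; simpl. now rewrite !vadd_0.
  - intros [x y]; simpl. now rewrite !vadd_opp.
  - intros [x y]; simpl. now rewrite !vscal_1.
  - intros a b [x y]; simpl. now rewrite !vscal_assoc.
  - intros a x y; simpl. now rewrite !vscal_distr_l.
  - intros a b x; simpl. now rewrite !vscal_distr_r.
  - intros [x y]; simpl. intros H. pose proof (vnorm_ge0 x). pose proof (vnorm_ge0 y).
    f_equal; apply vnorm_eq0; lra.
  - intros a x; simpl. rewrite !vnorm_scal. ring.
  - intros x y; simpl. pose proof (vnorm_triangle X (fst x) (fst y)).
    pose proof (vnorm_triangle Y (snd x) (snd y)). lra.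
Defined.

(** * Hahn-Banach *)

(** A convex subset of [E * R], standing for the epigraph of a convex function; points where the
    function is infinite are simply absent, and no extended arithmetic arises. *)
Definition convex_rel {E : NormedSpace} (D : E -> R -> Prop) : Prop :=
  forall v w r s t, 0 < t < 1 -> D v r -> D w s ->
    D (vadd (vscal t v) (vscal (1 - t) w)) (t * r + (1 - t) * s).

(** Models the epigraph of a sublinear functional; the last clause keeps the cone from going below 0
    over the origin. *)
Definition convex_cone {E : NormedSpace} (P : E * R -> Prop) : Prop :=
  (forall v w r s, P (v, r) -> P (w, s) -> P (vadd v w, r + s)) /\
  (forall v r t, 0 < t -> P (v, r) -> P (vscal t v, t * r)) /\
  (forall r, P (vzero, r) -> 0 <= r).

Lemma maximal_cone {E : NormedSpace} (P0 : E * R -> Prop) :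
  convex_cone P0 -> (exists u, P0 u) ->
  exists P, convex_cone P /\ (forall u, P0 u -> P u) /\
    forall Q, convex_cone Q -> (forall u, P u -> Q u) -> forall u, Q u -> P u.
Proof.
  intros H0 [u0 Hu0].
  (* Containment of [P0] is asked of nonempty sets only: the union of the empty chain is empty and
     must qualify too. *)
  destruct (@classical_sets.Zorn_bigcup (E * R)
    (fun P => convex_cone P /\ ((exists u, P u) -> forall u, P0 u -> P u)))
    as (P & [HP HP0] & Hmax).
  - intros F HF' Htot'.
    assert (HF : forall A, F A -> convex_cone A /\ ((exists u, A u) -> forall u, P0 u -> A u))
      by (intros A FA; exact (HF' A FA)).
    assert (Htot : forall A B, F A -> F B ->
              (forall u, A u -> B u) \/ (forall u, B u -> A u))
      by (intros A B FA FB; exact (Htot' A B FA FB)).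
    clear HF' Htot'. split.
    + split; [| split].
      * intros v w r s [A FA Av] [B FB Bw].
        destruct (Htot A B FA FB) as [AB | BA].
        -- exists B; [exact FB |]. destruct (HF B FB) as [[Hadd _] _]; apply Hadd; auto.
        -- exists A; [exact FA |]. destruct (HF A FA) as [[Hadd _] _]; apply Hadd; auto.
      * intros v r t Ht [A FA Av]. exists A; [exact FA |]. destruct (HF A FA) as [(_ & Hsc & _) _]; auto.
      * intros r [A FA Av]. destruct (HF A FA) as [(_ & _ & Hz) _]; auto.
    + intros [u [A FA Au]] v Hv. exists A; [exact FA |]. destruct (HF A FA) as [_ H]; apply H; [now exists u | exact Hv].
  - assert (Hne : exists u, P u).
    { apply NNPP; intros Hn. apply (Hmax P0).
      - split; [| intros HS; apply Hn; exists u0; now apply HS].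
        intros u Pu. elim Hn. now exists u.
      - now split. }
    exists P. split; [exact HP | split; [auto |]].
    intros Q HQ PQ u Qu. apply NNPP; intros nPu. apply (Hmax Q).
    + split; [exact PQ | intros HS; apply nPu; now apply HS].
    + split; [exact HQ | intros _ v Hv; apply PQ; auto].
Qed.

(** Zorn is applied to cones instead of partially defined functionals. The lower boundary [L] of a
    maximal cone is sublinear, and maximality makes it odd, hence linear. *)
Lemma total_cone_linear {E : NormedSpace} (P0 : E * R -> Prop) :
  convex_cone P0 -> (forall v, exists r, P0 (v, r)) ->
  exists L : E -> R, is_linear_fun L /\ forall v r, P0 (v, r) -> L v <= r.
Proof.
  intros H0 Htot0. destruct (maximal_cone P0 H0) as (P & (Hadd & Hscal & Hz) & H0P & Hmax).
  { destruct (Htot0 vzero) as [r Hr]. now exists (vzero, r). }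
  assert (Htot : forall v, exists r, P (v, r)).
  { intros v. destruct (Htot0 v) as [r Hr]. exists r. now apply H0P. }
  (* This is the infimum of the [r] with [P (v, r)], written through a supremum of negated
     values. *)
  set (L := fun v => - real_sup (fun m => P (v, - m))).
  assert (HL : forall v, is_lub (fun m => P (v, - m)) (- L v)).
  { intros v. unfold L. rewrite Ropp_involutive.
    destruct (Htot (vopp v)) as [s Hs].
    apply (real_sup_lub _ s).
    - destruct (Htot v) as [r Hr]. exists (- r). now rewrite Ropp_involutive.
    - intros m Hm. pose proof (Hadd _ _ _ _ Hm Hs) as H. rewrite vadd_opp in H.
      apply Hz in H. lra. }
  assert (Llow : forall v r, P (v, r) -> L v <= r).
  { intros v r Hr. destruct (HL v) as [H _]. specialize (H (- r)).
    simpl in H. rewrite Ropp_involutive in H. specialize (H Hr). lra. }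
  assert (Lglb : forall v b, (forall r, P (v, r) -> b <= r) -> b <= L v).
  { intros v b Hb. destruct (HL v) as [_ H]. specialize (H (- b)).
    enough (- L v <= - b) by lra. apply H. intros m Hm. specialize (Hb _ Hm). lra. }
  (* Maximality absorbs the ray through [(-y, - L y)]. *)
  assert (Hray : forall w y r, P (w, r) -> P (vsub w y, r - L y)).
  { intros w y r Hw.
    apply (Hmax (fun u => exists t, 0 <= t /\ P (vadd (fst u) (vscal t y), snd u + t * L y))).
    - split; [| split]; simpl.
      + intros v v' s s' (t & Ht & Hv) (t' & Ht' & Hv'). exists (t + t'). split; [lra |].
        replace (vadd (vadd v v') (vscal (t + t') y)) with
          (vadd (vadd v (vscal t y)) (vadd v' (vscal t' y))).
        * replace (s + s' + (t + t') * L y) with ((s + t * L y) + (s' + t' * L y)) by ring.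
          now apply Hadd.
        * rewrite vscal_distr_r, <- !vadd_assoc. f_equal.
          rewrite !vadd_assoc. f_equal. apply vadd_comm.
      + intros v s k Hk (t & Ht & Hv). exists (k * t). split; [nra |].
        rewrite <- vscal_assoc, <- vscal_distr_l.
        replace (k * s + k * t * L y) with (k * (s + t * L y)) by ring. now apply Hscal.
      + intros s (t & Ht & Hs). rewrite vadd_comm, vadd_0 in Hs.
        destruct (Req_dec t 0) as [-> | Hn].
        * rewrite vscal_0_l in Hs. apply Hz in Hs. lra.
        * assert (Hi : 0 < / t) by (apply Rinv_0_lt_compat; lra).
          (* Dividing by [t] gives [L y <= s / t + L y], so [s] is nonnegative and the enlarged set
             is still a cone. *)
          apply (Hscal _ _ (/ t) Hi), Llow in Hs.
          rewrite vscal_assoc, Rinv_l, vscal_1 in Hs by exact Hn.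
          apply (Rmult_le_compat_l t) in Hs; [| lra].
          rewrite <- Rmult_assoc, Rinv_r in Hs by exact Hn. lra.
    - intros [v s] Hv. exists 0. split; [lra |]. simpl.
      rewrite vscal_0_l, vadd_0, Rmult_0_l, Rplus_0_r. exact Hv.
    - exists 1. split; [lra |]. simpl. unfold vsub.
      rewrite vscal_1, <- vadd_assoc, (vadd_comm _ (vopp y)), vadd_opp, vadd_0.
      replace (r - L y + 1 * L y) with r by ring. exact Hw. }
  assert (Lsub : forall w y, L (vsub w y) <= L w - L y).
  { intros w y. enough (L (vsub w y) + L y <= L w) by lra.
    apply Lglb. intros r Hr. apply (Hray _ y) in Hr. apply Llow in Hr. lra. }
  assert (Lsup : forall v w, L (vadd v w) <= L v + L w).
  { intros v w. enough (L (vadd v w) - L v <= L w) by lra.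
    apply Lglb. intros s Hs. enough (L (vadd v w) - s <= L v) by lra.
    apply Lglb. intros r Hr. pose proof (Llow _ _ (Hadd _ _ _ _ Hr Hs)). lra. }
  assert (L0 : L vzero = 0).
  { apply Rle_antisym.
    - pose proof (Lsub vzero vzero) as H. unfold vsub in H. rewrite vadd_opp in H. lra.
    - apply Lglb. exact Hz. }
  assert (Lopp : forall v, L (vopp v) = - L v).
  { intros v. apply Rle_antisym.
    - pose proof (Lsub vzero v) as H. unfold vsub in H. rewrite vadd_comm, vadd_0 in H. lra.
    - pose proof (Lsup v (vopp v)) as H. rewrite vadd_opp in H. lra. }
  assert (Lpos : forall a v, 0 < a -> L (vscal a v) <= a * L v).
  { intros a v Ha. assert (Hi : 0 < / a) by (apply Rinv_0_lt_compat; lra).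
    enough (/ a * L (vscal a v) <= L v) as H.
    { apply (Rmult_le_compat_l a) in H; [| lra].
      rewrite <- Rmult_assoc, Rinv_r in H by lra. lra. }
    apply Lglb. intros r Hr. apply (Hscal _ _ a Ha), Llow in Hr.
    apply (Rmult_le_compat_l (/ a)) in Hr; [| lra].
    rewrite <- (Rmult_assoc (/ a) a), Rinv_l in Hr by lra. lra. }
  assert (Lpeq : forall a v, 0 < a -> L (vscal a v) = a * L v).
  { intros a v Ha. apply Rle_antisym; [now apply Lpos |].
    assert (Hi : 0 < / a) by (apply Rinv_0_lt_compat; lra).
    pose proof (Lpos (/ a) (vscal a v) Hi) as H.
    rewrite vscal_assoc, Rinv_l, vscal_1 in H by lra.
    apply (Rmult_le_compat_l a) in H; [| lra].
    rewrite <- Rmult_assoc, Rinv_r in H by lra. lra. }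
  exists L. split; [split |].
  - intros v w. apply Rle_antisym; [apply Lsup |].
    pose proof (Lsub v (vopp w)) as H. unfold vsub in H.
    rewrite Lopp, !vopp_scal, vscal_assoc in H.
    replace (-1 * -1) with 1 in H by ring. rewrite vscal_1 in H.
    pose proof (Lsub (vadd v w) w) as H1. unfold vsub in H1.
    rewrite <- vadd_assoc, vadd_opp, vadd_0 in H1.
    pose proof (Lsup (vadd v w) (vopp w)) as H2. rewrite Lopp, <- vadd_assoc, vadd_opp, vadd_0 in H2.
    lra.
  - intros a v. destruct (Rtotal_order a 0) as [Ha | [-> | Ha]].
    + replace (vscal a v) with (vopp (vscal (- a) v)).
      * rewrite Lopp, Lpeq by lra. ring.
      * rewrite vopp_scal, vscal_assoc. f_equal. ring.
    + rewrite vscal_0_l, L0. ring.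
    + now apply Lpeq.
  - intros v r Hr. apply Llow. now apply H0P.
Qed.

(** Passes to the cone generated by [D]: a point belongs to it when some positive multiple lies in
    [D]. *)
Lemma convex_rel_linear_minorant {E : NormedSpace} (D : E -> R -> Prop) :
  convex_rel D -> (forall v, exists r, D v r) -> (forall r, D vzero r -> 0 <= r) ->
  exists L : E -> R, is_linear_fun L /\ forall v r, D v r -> L v <= r.
Proof.
  intros Hc Ht Hz.
  destruct (total_cone_linear
    (fun u : E * R => exists t, 0 < t /\ D (vscal t (fst u)) (t * snd u))) as (L & HL & HLe).
  - split; [| split]; simpl.
    + intros v w r s (t & Ht0 & Hv) (t' & Ht0' & Hw).
      exists (t * t' / (t + t')). split.
      { apply Rdiv_lt_0_compat; [now apply Rmult_lt_0_compat | lra]. }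
      (* The weight is chosen so that [a * t = (1 - a) * t']; the convex combination of the two
         multiples is then a multiple of the sum. *)
      set (a := t' / (t + t')).
      assert (Ha : 0 < a < 1).
      { unfold a. split; [apply Rdiv_lt_0_compat; lra |].
        apply (Rmult_lt_reg_r (t + t')); [lra |]. unfold Rdiv.
        rewrite Rmult_assoc, Rinv_l; lra. }
      pose proof (Hc _ _ _ _ a Ha Hv Hw) as H.
      rewrite !vscal_assoc in H. rewrite vscal_distr_l.
      replace (t * t' / (t + t')) with (a * t) by (unfold a; field; lra).
      replace (a * t) with ((1 - a) * t') at 2 by (unfold a; field; lra).
      replace (a * t * (r + s)) with (a * (t * r) + (1 - a) * (t' * s)); [exact H |].
      replace (a * t * (r + s)) with (a * t * r + (a * t) * s) by ring.
      replace (a * t * s) with ((1 - a) * t' * s); [ring |].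
      unfold a; field; lra.
    + intros v r k Hk (t & Ht0 & Hv). exists (t / k). split; [now apply Rdiv_lt_0_compat |].
      rewrite vscal_assoc. replace (t / k * k) with t by (field; lra).
      replace (t / k * (k * r)) with (t * r) by (field; lra). exact Hv.
    + intros r (t & Ht0 & Hr).
      replace (vscal t (vzero : E)) with (vzero : E) in Hr
        by (symmetry; apply vnorm_eq0; rewrite vnorm_scal, vnorm_zero; ring).
      apply Hz in Hr. nra.
  - intros v. destruct (Ht v) as [r Hr]. exists r, 1. split; [lra |]. simpl.
    now rewrite vscal_1, Rmult_1_l.
  - exists L. split; [exact HL |]. intros v r Hr. apply HLe. exists 1. split; [lra |]. simpl.
    now rewrite vscal_1, Rmult_1_l.
Qed.

Lemma linear_fun_zero {E : NormedSpace} (L : E -> R) : is_linear_fun L -> L vzero = 0.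
Proof. intros [_ H]. rewrite <- (vscal_0_l vzero), H. ring. Qed.

Lemma linear_fun_bounded {E : NormedSpace} (L : E -> R) d K :
  is_linear_fun L -> 0 < d -> (forall v, vnorm v <= d -> L v <= K) -> is_bounded_fun L.
Proof.
  intros HL Hd HK. exists (K / d). intros v.
  assert (H : forall w, L w <= K / d * vnorm w).
  { intros w. pose proof (vnorm_ge0 w).
    destruct (Req_dec (vnorm w) 0) as [H0 | H0].
    { rewrite H0, (vnorm_eq0 _ _ H0), linear_fun_zero by assumption. lra. }
    assert (Hq : 0 < d / vnorm w) by (apply Rdiv_lt_0_compat; lra).
    assert (H1 : L (vscal (d / vnorm w) w) <= K).
    { apply HK. rewrite vnorm_scal, Rabs_right by lra. apply Req_le. field. exact H0. }
    rewrite (proj2 HL) in H1.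
    apply (Rmult_le_compat_l (vnorm w / d)) in H1; [| apply Rlt_le, Rdiv_lt_0_compat; lra].
    replace (vnorm w / d * (d / vnorm w * L w)) with (L w) in H1 by (field; lra).
    replace (K / d * vnorm w) with (vnorm w / d * K) by (field; lra). exact H1. }
  apply Rabs_le. split; [| apply H].
  pose proof (H (vopp v)) as H1. rewrite vnorm_opp, vopp_scal, (proj2 HL) in H1. lra.
Qed.

(** The functional is a subgradient of the norm at [a]: a linear minorant of
    [vnorm (vadd a v) - vnorm a]. The triangle inequality bounds it by the norm, and [v = vopp a]
    gives equality at [a]. *)
Lemma norming_functional {E : NormedSpace} (a : E) :
  exists f : Dual E, pair a f = vnorm a /\ dnorm f <= 1.
Proof.
  destruct (convex_rel_linear_minorant (fun v r => vnorm (vadd a v) - vnorm a <= r))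
    as (L & HL & HLe).
  - intros v w r s t Ht Hv Hw.
    replace (vadd a (vadd (vscal t v) (vscal (1 - t) w)))
      with (vadd (vscal t (vadd a v)) (vscal (1 - t) (vadd a w))).
    + eapply Rle_trans; [apply Rplus_le_compat_r, vnorm_triangle |].
      rewrite !vnorm_scal, !Rabs_right by lra. nra.
    + rewrite !vscal_distr_l.
      rewrite <- (vadd_assoc _ (vscal t a)), (vadd_assoc _ (vscal t v)).
      rewrite (vadd_comm _ (vscal t v)), <- (vadd_assoc _ (vscal (1 - t) a)), vadd_assoc.
      rewrite <- vscal_distr_r. replace (t + (1 - t)) with 1 by ring. now rewrite vscal_1.
  - intros v. eexists. apply Rle_refl.
  - intros r. rewrite vadd_0. lra.
  - assert (H1 : forall v, L v <= vnorm v).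
    { intros v. apply HLe. pose proof (vnorm_triangle _ a v). lra. }
    assert (H2 : forall v, Rabs (L v) <= 1 * vnorm v).
    { intros v. rewrite Rmult_1_l. apply Rabs_le. split; [| apply H1].
      pose proof (H1 (vopp v)) as H. rewrite vnorm_opp, vopp_scal, (proj2 HL) in H. lra. }
    exists (exist _ L (conj HL (ex_intro _ 1 H2))). split.
    + unfold pair; simpl. apply Rle_antisym; [apply H1 |].
      assert (H : L (vopp a) <= - vnorm a) by (apply HLe; rewrite vadd_opp, vnorm_zero; lra).
      rewrite vopp_scal, (proj2 HL) in H. lra.
    + apply dnorm_le; [lra | exact H2].
Qed.

(** Functionals separate points, so vector identities can be checked after pairing, where [ring]
    applies; the tactic [vec] does this. *)
Lemma vec_ext {E : NormedSpace} (x y : E) : (forall f, pair x f = pair y f) -> x = y.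
Proof.
  intros H. destruct (norming_functional (vsub x y)) as (f & Hf & _).
  rewrite pair_sub, H, Rminus_diag in Hf. symmetry in Hf. apply vnorm_eq0 in Hf.
  rewrite <- (vadd_0 _ y), <- Hf. unfold vsub.
  now rewrite (vadd_comm _ x), vadd_assoc, vadd_opp, vadd_comm, vadd_0.
Qed.

Ltac vec := apply vec_ext; intros ?; pairs; try ring.

Lemma vsub_triangle {E : NormedSpace} (x y z : E) :
  vnorm (vsub x z) <= vnorm (vsub x y) + vnorm (vsub y z).
Proof.
  replace (vsub x z) with (vadd (vsub x y) (vsub y z)) by vec. apply vnorm_triangle.
Qed.

Lemma vsub_sym {E : NormedSpace} (x y : E) : vnorm (vsub x y) = vnorm (vsub y x).
Proof. rewrite <- vnorm_opp. f_equal. vec. Qed.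

Definition convex_fun {E : NormedSpace} (k : E -> R) : Prop :=
  forall v w t, 0 < t < 1 ->
    k (vadd (vscal t v) (vscal (1 - t) w)) <= t * k v + (1 - t) * k w.

(* Hahn-Banach for the epigraph of the infimal convolution [inf_u (S u + k (u + v))]. *)
Lemma sandwich {E : NormedSpace} (S : E -> R -> Prop) (k : E -> R) v0 r0 M d :
  convex_rel S -> convex_fun k -> (forall v r, S v r -> 0 <= r + k v) -> S v0 r0 ->
  0 < d -> (forall w, vnorm w <= d -> k (vadd v0 w) <= M) ->
  exists L : E -> R, is_linear_fun L /\ is_bounded_fun L /\
    forall v r w, S v r -> L w - L v <= r + k w.
Proof.
  intros HS Hk Hpos H0 Hd HM.
  destruct (convex_rel_linear_minorant
    (fun v q => exists u r, S u r /\ r + k (vadd u v) <= q)) as (L & HL & HLe).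
  - intros v w q q' t Ht (u & r & Hu & Hq) (u' & r' & Hu' & Hq').
    exists (vadd (vscal t u) (vscal (1 - t) u')), (t * r + (1 - t) * r').
    split; [now apply HS |].
    replace (vadd (vadd (vscal t u) (vscal (1 - t) u')) (vadd (vscal t v) (vscal (1 - t) w)))
      with (vadd (vscal t (vadd u v)) (vscal (1 - t) (vadd u' w))) by vec.
    pose proof (Hk (vadd u v) (vadd u' w) t Ht). nra.
  - intros v. exists (r0 + k (vadd v0 v)), v0, r0. split; [exact H0 | lra].
  - intros q (u & r & Hu & Hq). rewrite vadd_0 in Hq. pose proof (Hpos _ _ Hu). lra.
  - exists L. split; [exact HL | split].
    + apply (linear_fun_bounded L d (r0 + M) HL Hd). intros v Hv. apply HLe.
      exists v0, r0. split; [exact H0 |]. pose proof (HM v Hv). lra.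
    (* Evaluating the infimal convolution at [w - v] with [u = v] puts [w] into [k]. *)
    + intros v r w Hv. assert (H : L (vsub w v) <= r + k w).
      { apply HLe. exists v, r. split; [exact Hv |].
        replace (vadd v (vsub w v)) with w by vec. lra. }
      unfold vsub in H. rewrite (proj1 HL), vopp_scal, (proj2 HL) in H. lra.
Qed.

(** * Completeness *)

Lemma dual_complete (X : NormedSpace) : complete (dual_space X).
Proof.
  intros u Hu. change (nat -> Dual X) in u.
  assert (Hu' : forall eps, 0 < eps -> exists N, forall n m, (N <= n)%nat -> (N <= m)%nat ->
            forall x, Rabs (pair x (u n) - pair x (u m)) <= eps * vnorm x).
  { intros eps He. destruct (Hu eps He) as [N HN]. exists N. intros n m Hn Hm x.
    specialize (HN n m Hn Hm). rewrite <- pair_dsub.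
    eapply Rle_trans; [apply pair_le |].
    apply Rmult_le_compat_r; [apply vnorm_ge0 |]. apply Rlt_le. exact HN. }
  assert (Hcv : forall x, exists l, Un_cv (fun n => pair x (u n)) l).
  { intros x. destruct (R_complete (fun n => pair x (u n))) as [l Hl]; [| now exists l].
    intros eps He. pose proof (vnorm_ge0 x).
    destruct (Hu' (eps / (vnorm x + 1))) as [N HN]; [apply Rdiv_lt_0_compat; lra |].
    exists N. intros n m Hn Hm. unfold Rdist. eapply Rle_lt_trans; [apply HN; auto |].
    unfold Rdiv. rewrite Rmult_assoc. rewrite <- (Rmult_1_r eps) at 2.
    apply Rmult_lt_compat_l; [exact He |].
    apply (Rmult_lt_reg_l (vnorm x + 1)); [lra |]. field_simplify; lra. }
  set (f := fun x => proj1_sig (constructive_indefinite_description _ (Hcv x))).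
  assert (Hf : forall x, Un_cv (fun n => pair x (u n)) (f x)).
  { intros x. unfold f. now destruct constructive_indefinite_description. }
  assert (Hlin : is_linear_fun f).
  { split.
    - intros x y. apply (UL_sequence (fun n => pair (vadd x y) (u n))); [apply Hf |].
      intros eps He. destruct (CV_plus _ _ _ _ (Hf x) (Hf y) eps He) as [N HN].
      exists N. intros n Hn. rewrite pair_add. now apply HN.
    - intros a x. apply (UL_sequence (fun n => pair (vscal a x) (u n))); [apply Hf |].
      intros eps He.
      assert (Ha : Un_cv (fun _ => a) a).
      { intros e' He'. exists 0%nat. intros. now rewrite Rdist_eq. }
      destruct (CV_mult _ _ _ _ Ha (Hf x) eps He) as [N HN].
      exists N. intros n Hn. rewrite pair_scal. now apply HN. }
  (* The second index of the Cauchy estimate tends to infinity pointwise, which keeps the bound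
     uniform in [x]. *)
  assert (Hlim : forall eps, 0 < eps -> exists N, forall n, (N <= n)%nat ->
            forall x, Rabs (pair x (u n) - f x) <= eps * vnorm x).
  { intros eps He. destruct (Hu' eps He) as [N HN]. exists N. intros n Hn x.
    apply le_epsilon. intros e' He'. destruct (Hf x e' He') as [N' HN'].
    specialize (HN n (max N N') Hn (Nat.le_max_l _ _) x).
    specialize (HN' (max N N') (Nat.le_max_r _ _)). unfold Rdist in HN'.
    replace (pair x (u n) - f x) with
      ((pair x (u n) - pair x (u (max N N'))) + (pair x (u (max N N')) - f x)) by ring.
    eapply Rle_trans; [apply Rabs_triang |]. lra. }
  assert (Hbd : is_bounded_fun f).
  { destruct (Hlim 1 Rlt_0_1) as [N HN]. exists (dnorm (u N) + 1). intros x.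
    specialize (HN N (le_n N) x). pose proof (pair_le x (u N)).
    replace (f x) with (pair x (u N) + - (pair x (u N) - f x)) by ring.
    eapply Rle_trans; [apply Rabs_triang |]. rewrite Rabs_Ropp. lra. }
  exists (exist _ f (conj Hlin Hbd)). intros eps He.
  destruct (Hlim (eps / 2)) as [N HN]; [lra |]. exists N. intros n Hn.
  apply Rle_lt_trans with (eps / 2); [| lra].
  apply (dnorm_le (X := X)); [lra |]. intros x.
  change (Rabs (pair x (dsub (u n) (exist _ f (conj Hlin Hbd)))) <= eps / 2 * vnorm x).
  rewrite pair_dsub. now apply HN.
Qed.

Lemma prod_complete (X Y : NormedSpace) :
  complete X -> complete Y -> complete (prod_space X Y).
Proof.
  intros HX HY u Hu.
  assert (Hn : forall n m, vnorm (vsub (u n) (u m)) =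
    vnorm (vsub (fst (u n)) (fst (u m))) + vnorm (vsub (snd (u n)) (snd (u m))))
    by reflexivity.
  destruct (HX (fun n => fst (u n))) as [l Hl].
  { intros eps He. destruct (Hu eps He) as [N HN]. exists N. intros n m Hn' Hm.
    specialize (HN n m Hn' Hm). rewrite Hn in HN.
    pose proof (vnorm_ge0 (vsub (snd (u n)) (snd (u m)))). lra. }
  destruct (HY (fun n => snd (u n))) as [l' Hl'].
  { intros eps He. destruct (Hu eps He) as [N HN]. exists N. intros n m Hn' Hm.
    specialize (HN n m Hn' Hm). rewrite Hn in HN.
    pose proof (vnorm_ge0 (vsub (fst (u n)) (fst (u m)))). lra. }
  exists (l, l'). intros eps He.
  destruct (Hl (eps / 2)) as [N HN]; [lra |]. destruct (Hl' (eps / 2)) as [N' HN']; [lra |].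
  exists (max N N'). intros n Hm.
  specialize (HN n ltac:(lia)). specialize (HN' n ltac:(lia)).
  change (vnorm (vsub (fst (u n)) l) + vnorm (vsub (snd (u n)) l') < eps). lra.
Qed.

(* Baire's argument by nested balls, each chosen in a region where some [l i] exceeds [n]. *)
Lemma locally_bounded_of_pointwise {E : NormedSpace} (I : Type) (l : I -> E -> R) (k : E -> R) :
  complete E ->
  (forall i, exists M, forall v w, Rabs (l i v - l i w) <= M * vnorm (vsub v w)) ->
  (forall i v, l i v <= k v) ->
  exists c d M, 0 < d /\ forall v i, vnorm (vsub v c) <= d -> l i v <= M.
Proof.
  intros HE Hlip Hk. apply NNPP; intros Hno.
  assert (Hun : forall c d M, 0 < d -> exists v i, vnorm (vsub v c) <= d /\ M < l i v).
  { intros c d M Hd. apply NNPP; intros H. apply Hno. exists c, d, M. split; [exact Hd |].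
    intros v i Hv. apply Rnot_lt_le; intros Hl. apply H. now exists v, i. }
  (* Positivity of the radius is assumed under the existential, so that choice gives a step function
     defined on all pairs. *)
  assert (Hstep : forall (n : nat) (p : E * R), exists q : E * R, 0 < snd p ->
    0 < snd q <= / INR (S n) /\
    (forall v, vnorm (vsub v (fst q)) <= snd q -> vnorm (vsub v (fst p)) <= snd p) /\
    (exists i, forall v, vnorm (vsub v (fst q)) <= snd q -> INR n < l i v)).
  { intros n [c d]; cbn [fst snd].
    destruct (Rlt_le_dec 0 d) as [Hd | Hd]; [| exists (c, d); intros; lra].
    destruct (Hun c (d / 2) (INR n)) as (v & i & Hv & Hl); [lra |].
    destruct (Hlip i) as [M HM]. pose proof (Rabs_pos M). pose proof (Rle_abs M).
    (* Within distance [g] of [v] the Lipschitz bound lets [l i] lose at most half of its excess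
       over [INR n]; the [+ 1] avoids a zero denominator. *)
    set (g := (l i v - INR n) / (2 * (Rabs M + 1))).
    assert (Hg : 0 < g) by (apply Rdiv_lt_0_compat; lra).
    assert (Hg' : g * (Rabs M + 1) = (l i v - INR n) / 2) by (unfold g; field; lra).
    assert (Hn : 0 < / INR (S n)) by (apply Rinv_0_lt_compat, lt_0_INR; lia).
    exists (v, Rmin (/ INR (S n)) (Rmin (d / 2) g)). intros _; cbn [fst snd].
    pose proof (Rmin_l (/ INR (S n)) (Rmin (d / 2) g)).
    pose proof (Rmin_r (/ INR (S n)) (Rmin (d / 2) g)).
    pose proof (Rmin_l (d / 2) g). pose proof (Rmin_r (d / 2) g).
    split; [split; [repeat apply Rmin_glb_lt; lra | assumption] | split].
    - intros w Hw. pose proof (vsub_triangle w v c). lra.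
    - exists i. intros w Hw. pose proof (HM v w) as H'. rewrite vsub_sym in H'.
      pose proof (Rle_abs (l i v - l i w)). pose proof (vnorm_ge0 (vsub w v)). nra. }
  set (step := fun n p => proj1_sig (constructive_indefinite_description _ (Hstep n p))).
  set (s := fix s n := match n with O => (vzero, 1) | S n => step n (s n) end).
  assert (Hs : forall n, 0 < snd (s n)).
  { induction n as [| n IH]; [simpl; lra |].
    simpl. unfold step. destruct constructive_indefinite_description as [q Hq]. simpl.
    now apply Hq. }
  assert (Hss : forall n, snd (s (S n)) <= / INR (S n) /\
    (forall v, vnorm (vsub v (fst (s (S n)))) <= snd (s (S n)) ->
       vnorm (vsub v (fst (s n))) <= snd (s n)) /\
    (exists i, forall v, vnorm (vsub v (fst (s (S n)))) <= snd (s (S n)) -> INR n < l i v)).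
  { intros n. pose proof (Hs n). change (s (S n)) with (step n (s n)). unfold step.
    destruct constructive_indefinite_description as [q Hq]. simpl proj1_sig.
    destruct (Hq H) as ([_ H1] & H2 & H3). auto. }
  clearbody s. clear step.
  assert (Hnest : forall n m, (n <= m)%nat -> forall v,
    vnorm (vsub v (fst (s m))) <= snd (s m) -> vnorm (vsub v (fst (s n))) <= snd (s n)).
  { induction 1 as [| m Hm IH]; [auto |]. intros v Hv. apply IH. now apply (Hss m). }
  assert (Hcen : forall n m, (n <= m)%nat -> vnorm (vsub (fst (s m)) (fst (s n))) <= snd (s n)).
  { intros n m Hm. apply (Hnest n m Hm). unfold vsub. rewrite vadd_opp, vnorm_zero.
    apply Rlt_le, Hs. }
  destruct (HE (fun n => fst (s n))) as [x Hx].
  { intros eps He. destruct (archimed_cor1 (eps / 2)) as (N & HN & HN0); [lra |].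
    exists N. intros n m Hn Hm. destruct N as [| N]; [lia |].
    pose proof (Hcen _ _ Hn). pose proof (Hcen _ _ Hm) as H1. rewrite vsub_sym in H1.
    pose proof (vsub_triangle (fst (s n)) (fst (s (S N))) (fst (s m))).
    destruct (Hss N) as [H3 _]. lra. }
  assert (Hxb : forall n, vnorm (vsub x (fst (s n))) <= snd (s n)).
  { intros n. apply le_epsilon. intros eps He. destruct (Hx eps He) as [N HN].
    specialize (HN (max N n) ltac:(lia)). rewrite vsub_sym in HN.
    pose proof (Hcen n (max N n) ltac:(lia)).
    pose proof (vsub_triangle x (fst (s (max N n))) (fst (s n))). lra. }
  destruct (INR_unbounded (k x)) as [n Hn].
  destruct (Hss n) as (_ & _ & i & Hi). specialize (Hi x (Hxb (S n))).
  pose proof (Hk i x). lra.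
Qed.

(** Splits [L (x, f)] into [L (x, 0)], an element of the dual, and [L (0, f)], a functional on the
    dual that reflexivity represents by a vector. *)
Lemma bounded_functional_on_product {X : NormedSpace} (L : prod_space X (dual_space X) -> R) :
  reflexive X -> is_linear_fun L -> is_bounded_fun L ->
  exists (a : X) (b : Dual X), forall x f, L (x, f) = pair x b + pair a f.
Proof.
  intros HX [Ha Hs] [M HM].
  assert (H1 : is_linear_fun (fun x : X => L (x, dzero X)) /\
               is_bounded_fun (fun x : X => L (x, dzero X))).
  { split; [split |].
    - intros x y. rewrite <- Ha. f_equal. simpl. f_equal.
      apply dual_ext; intros v. pairs. unfold pair; simpl. ring.
    - intros a x. rewrite <- Hs. f_equal. simpl. f_equal.
      apply dual_ext; intros v. pairs. unfold pair; simpl. ring.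
    - exists M. intros x. eapply Rle_trans; [apply HM |]. simpl. apply Req_le. f_equal.
      rewrite (vnorm_zero (dual_space X) : dnorm (dzero X) = 0). ring. }
  destruct (HX (fun f => L (vzero, f))) as [a Haa].
  - intros f g. rewrite <- Ha. f_equal. simpl. f_equal. now rewrite vadd_0.
  - intros c f. rewrite <- Hs. f_equal. simpl. f_equal. vec.
  - exists M. intros f. eapply Rle_trans; [apply HM |]. simpl. rewrite vnorm_zero.
    apply Req_le. ring.
  - exists a, (exist _ (fun x : X => L (x, dzero X)) H1). intros x f. rewrite <- Haa. unfold pair at 1; simpl.
    rewrite <- Ha. f_equal. simpl. f_equal.
    + vec.
    + apply dual_ext; intros v. pairs. unfold pair at 2; simpl. ring.
Qed.

(** * The Fitzpatrick function and the function Psi *)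

Lemma Rbar_le_trans a b c : Rbar_le a b -> Rbar_le b c -> Rbar_le a c.
Proof. destruct a, b, c; simpl; try tauto; lra. Qed.

Lemma Rbar_le_antisym a b : Rbar_le a b -> Rbar_le b a -> a = b.
Proof. destruct a, b; simpl; try tauto. intros. f_equal. lra. Qed.

Lemma Rbar_opp_le a b : Rbar_le (Rbar_opp a) (Rbar_opp b) <-> Rbar_le b a.
Proof. destruct a, b; simpl; try tauto. lra. Qed.

Lemma Rbar_opp_involutive a : Rbar_opp (Rbar_opp a) = a.
Proof. destruct a; simpl; try reflexivity. f_equal. ring. Qed.

Lemma Rbar_lub_exists (P : Rbar -> Prop) : exists s, Rbar_is_lub P s.
Proof.
  destruct (classic (exists M, forall r, P r -> Rbar_le r (Fin M))) as [[M HM] | Hn].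
  - destruct (classic (exists r, P (Fin r))) as [Hr | Hr].
    + destruct (completeness (fun r => P (Fin r))) as [s [Hs1 Hs2]].
      { exists M. intros r H. exact (HM _ H). }
      { exact Hr. }
      exists (Fin s). split.
      * intros [r | |] H; [exact (Hs1 _ H) | exact (HM _ H) | exact I].
      * intros [u | |] Hu; simpl; [apply Hs2; intros r H; exact (Hu _ H) | exact I |].
        destruct Hr as [r Hr]. exact (Hu _ Hr).
    + exists MInf. split; [| intros; exact I].
      intros [r | |] H; [elim Hr; now exists r | exact (HM _ H) | exact I].
  - exists PInf. split; [intros [] _; exact I |].
    intros [u | |] Hu; [elim Hn; now exists u | exact I |].
    elim Hn. exists 0. intros r H. apply Rbar_le_trans with MInf; [now apply Hu | exact I].
Qed.

(** Every set of extended reals has a least upper bound, so [epsilon] never returns its default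
    here. *)
Lemma Rbar_sup_lub (P : Rbar -> Prop) : Rbar_is_lub P (Rbar_sup P).
Proof. unfold Rbar_sup. apply epsilon_spec, Rbar_lub_exists. Qed.

Lemma Rbar_inf_glb (P : Rbar -> Prop) : Rbar_is_glb P (Rbar_inf P).
Proof.
  unfold Rbar_inf. apply epsilon_spec.
  destruct (Rbar_lub_exists (fun r => P (Rbar_opp r))) as [s [H1 H2]].
  exists (Rbar_opp s). split.
  - intros r H. rewrite <- (Rbar_opp_involutive r), Rbar_opp_le. apply H1.
    now rewrite Rbar_opp_involutive.
  - intros u H. rewrite <- (Rbar_opp_involutive u), Rbar_opp_le. apply H2.
    intros r Hr. rewrite <- (Rbar_opp_involutive r), Rbar_opp_le. now apply H.
Qed.

(** * Real epigraphs of the Fitzpatrick function, its conjugate and Psi *)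

Definition monotone_op {X : NormedSpace} (A : SetOp X) : Prop :=
  forall x xs y ys, A x xs -> A y ys -> 0 <= pair (vsub x y) (dsub xs ys).

Definition Fitz_epi {X : NormedSpace} (A : SetOp X) (y : X) (ys : Dual X) (a : R) : Prop :=
  forall v vs, A v vs -> pair y vs + pair v ys - pair v vs <= a.

(** The vector comes first here, whereas the conjugate takes the functional first. Points where the
    Fitzpatrick function is infinite have no real [a] and impose no condition. *)
Definition Conj_epi {X : NormedSpace} (A : SetOp X) (z : X) (zs : Dual X) (b : R) : Prop :=
  forall x xs a, Fitz_epi A x xs a -> pair x zs + pair z xs - a <= b.

(* The decomposition is explicit, so [Psi x xs <= r] only gives [Psi_epi A x xs (r + e)] for
   every [e > 0]: the infimum defining Psi is not known to be attained. *)
Definition Psi_epi {X : NormedSpace} (A : SetOp X) (x : X) (xs : Dual X) (r : R) : Prop :=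
  exists (y z : X) (ys zs : Dual X) (a b : R),
    vadd y z = vscal 2 x /\ dadd ys zs = dscal 2 xs /\
    Fitz_epi A y ys a /\ Conj_epi A z zs b /\
    a / 2 + b / 2 + 1 / 8 * (vnorm (vsub y z) ^ 2 + dnorm (dsub ys zs) ^ 2) <= r.

Lemma Fitz_epi_graph {X : NormedSpace} (A : SetOp X) v vs :
  monotone_op A -> A v vs -> Fitz_epi A v vs (pair v vs).
Proof.
  intros HA Hv w ws Hw. pose proof (HA _ _ _ _ Hv Hw) as H. pairs_in H. lra.
Qed.

Lemma Conj_epi_graph {X : NormedSpace} (A : SetOp X) v vs :
  A v vs -> Conj_epi A v vs (pair v vs).
Proof. intros Hv x xs a H. pose proof (H _ _ Hv). lra. Qed.

Lemma Fitzpatrick_le {X : NormedSpace} (A : SetOp X) x xs r :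
  Rbar_le (Fitzpatrick A x xs) (Fin r) <-> Fitz_epi A x xs r.
Proof.
  unfold Fitzpatrick. match goal with |- context [Rbar_sup ?P] =>
    destruct (Rbar_sup_lub P) as [H1 H2] end.
  split.
  - intros H v vs Hv.
    refine (Rbar_le_trans (Fin _) _ (Fin _) (H1 _ _) H). now exists v, vs.
  - intros H. apply H2. intros q (v & vs & Hv & ->). now apply H.
Qed.

(** A graph point contributes a real number to the supremum. Together with the analogue for the
    conjugate, this keeps sums of opposite infinities out of Psi. *)
Lemma Fitzpatrick_not_MInf {X : NormedSpace} (A : SetOp X) x xs v vs :
  A v vs -> Fitzpatrick A x xs <> MInf.
Proof.
  intros Hv E. assert (H : forall r, pair x vs + pair v xs - pair v vs <= r).
  { intros r. apply (proj1 (Fitzpatrick_le A x xs r)); [rewrite E; exact I | exact Hv]. }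
  pose proof (H (pair x vs + pair v xs - pair v vs - 1)). lra.
Qed.

Lemma Fenchel_conj_le {X : NormedSpace} (A : SetOp X) z zs r v vs :
  A v vs -> Rbar_le (Fenchel_conj (Fitzpatrick A) zs z) (Fin r) <-> Conj_epi A z zs r.
Proof.
  intros Hv. unfold Fenchel_conj. match goal with |- context [Rbar_sup ?P] =>
    destruct (Rbar_sup_lub P) as [H1 H2] end.
  split.
  - intros H x xs a Ha. apply Fitzpatrick_le in Ha.
    assert (H3 := Rbar_le_trans _ _ _ (H1 _ (ex_intro _ x (ex_intro _ xs eq_refl))) H).
    pose proof (Fitzpatrick_not_MInf A x xs _ _ Hv) as Hn.
    destruct (Fitzpatrick A x xs); simpl in *; [lra | tauto | tauto].
  - intros H. apply H2. intros q (x & xs & ->).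
    pose proof (Fitzpatrick_not_MInf A x xs _ _ Hv) as Hn.
    destruct (Fitzpatrick A x xs) eqn:E; simpl; [| exact I | tauto].
    apply (Rle_trans _ (pair x zs + pair z xs - r0)); [lra |].
    apply H, Fitzpatrick_le. rewrite E. apply Rle_refl.
Qed.

Lemma Fenchel_conj_not_MInf {X : NormedSpace} (A : SetOp X) z zs v vs :
  monotone_op A -> A v vs -> Fenchel_conj (Fitzpatrick A) zs z <> MInf.
Proof.
  intros HA Hv E.
  assert (H : forall r, pair v zs + pair z vs - pair v vs <= r).
  { intros r. apply (proj1 (Fenchel_conj_le A z zs r _ _ Hv)); [rewrite E; exact I |].
    now apply Fitz_epi_graph. }
  pose proof (H (pair v zs + pair z vs - pair v vs - 1)). lra.
Qed.

(** Replaces the extended-real infimum by a lower bound and an approximation property in [R]; all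
    later arguments use only the right-hand side. *)
Lemma Psi_eq_Fin {X : NormedSpace} (A : SetOp X) x xs s v vs :
  monotone_op A -> A v vs ->
  (Psi_fun (Fitzpatrick A) x xs = Fin s <->
   (forall r, Psi_epi A x xs r -> s <= r) /\ (forall e, 0 < e -> Psi_epi A x xs (s + e))).
Proof.
  intros HA Hv. unfold Psi_fun.
  match goal with |- context [Rbar_inf ?Q] => set (P := Q) end.
  destruct (Rbar_inf_glb P) as [H1 H2].
  assert (Hin : forall r, Psi_epi A x xs r -> exists q, P q /\ Rbar_le q (Fin r)).
  { intros r (y & z & ys & zs & a & b & Hy & Hys & Ha & Hb & Hr).
    eexists. split; [exists y, z, ys, zs; split; [exact Hy | split; [exact Hys | reflexivity]] |].
    apply Fitzpatrick_le in Ha. apply (Fenchel_conj_le _ _ _ _ _ _ Hv) in Hb.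
    pose proof (Fitzpatrick_not_MInf A y ys _ _ Hv).
    pose proof (Fenchel_conj_not_MInf A z zs _ _ HA Hv).
    destruct (Fitzpatrick A y ys), (Fenchel_conj (Fitzpatrick A) zs z); cbn in *; try tauto. lra. }
  assert (Hout : forall q r, P q -> Rbar_le q (Fin r) -> Psi_epi A x xs r).
  { intros q r (y & z & ys & zs & Hy & Hys & ->) Hr.
    pose proof (Fitzpatrick_not_MInf A y ys _ _ Hv).
    pose proof (Fenchel_conj_not_MInf A z zs _ _ HA Hv).
    destruct (Fitzpatrick A y ys) as [a | |] eqn:Ea; cbn in *; try tauto.
    destruct (Fenchel_conj (Fitzpatrick A) zs z) as [b | |] eqn:Eb; cbn in *; try tauto.
    exists y, z, ys, zs, a, b. repeat split; try assumption.
    - apply Fitzpatrick_le. rewrite Ea. apply Rle_refl.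
    - apply (Fenchel_conj_le _ _ _ _ _ _ Hv). rewrite Eb. apply Rle_refl. }
  split.
  - intros E. rewrite E in H1, H2. split.
    + intros r Hr. destruct (Hin r Hr) as (q & Hq & Hqr).
      exact (Rbar_le_trans _ _ _ (H1 _ Hq) Hqr).
    + intros e He. apply NNPP; intros Hn.
      enough (H : Rbar_le (Fin (s + e)) (Fin s)) by (simpl in H; lra).
      apply H2. intros q Hq. destruct q as [q | |]; simpl; [| exact I |].
      * apply Rnot_lt_le; intros Hlt. apply Hn, (Hout _ _ Hq). simpl. lra.
      * apply Hn, (Hout _ _ Hq). exact I.
  - intros [Hlow Happ]. apply Rbar_le_antisym.
    + assert (H : forall e, 0 < e -> Rbar_le (Rbar_inf P) (Fin (s + e))).
      { intros e He. destruct (Hin _ (Happ e He)) as (q & Hq & Hqr).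
        exact (Rbar_le_trans _ _ _ (H1 _ Hq) Hqr). }
      destruct (Rbar_inf P); simpl in *; [apply le_epsilon; exact H | exact (H 1 Rlt_0_1) | exact I].
    + apply H2. intros [q | |] Hq; simpl; [| exact I |].
      * apply Hlow, (Hout _ _ Hq). apply Rle_refl.
      * pose proof (Hlow (s - 1) (Hout _ _ Hq I)). lra.
Qed.

Lemma Psi_epi_graph {X : NormedSpace} (A : SetOp X) v vs :
  monotone_op A -> A v vs -> Psi_epi A v vs (pair v vs).
Proof.
  intros HA Hv. exists v, v, vs, vs, (pair v vs), (pair v vs).
  split; [vec | split; [apply dual_ext; intros w; pairs; ring |]].
  split; [now apply Fitz_epi_graph | split; [now apply Conj_epi_graph |]].
  replace (vsub v v) with (vscal 0 v) by vec.
  replace (dsub vs vs) with (dscal 0 vs) by (apply dual_ext; intros w; pairs; ring).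
  rewrite vnorm_scal, dnorm_scal, Rabs_R0. lra.
Qed.

Lemma Psi_epi_mono {X : NormedSpace} (A : SetOp X) x xs r r' :
  r <= r' -> Psi_epi A x xs r -> Psi_epi A x xs r'.
Proof.
  intros Hr (y & z & ys & zs & a & b & H1 & H2 & H3 & H4 & H5).
  exists y, z, ys, zs, a, b. repeat split; try assumption. lra.
Qed.

(** Fenchel-Young gives [a + b >= <y, zs> + <z, ys>], and by polarization the right side is
    [2 <x, xs> - <y - z, ys - zs> / 2]. After halving, the quadratic term absorbs the last pairing,
    since [n m / 4 <= (n^2 + m^2) / 8]. *)
Lemma Psi_epi_pair {X : NormedSpace} (A : SetOp X) x xs r :
  Psi_epi A x xs r -> pair x xs <= r.
Proof.
  intros (y & z & ys & zs & a & b & Hy & Hys & Ha & Hb & Hr).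
  pose proof (Hb _ _ _ Ha) as H.
  pose proof (f_equal (fun v => pair v ys) Hy) as E1.
  pose proof (f_equal (fun v => pair v zs) Hy) as E2.
  pose proof (f_equal (fun f => pair x f) Hys) as E3.
  simpl in E1, E2, E3. pairs_in E1. pairs_in E2. pairs_in E3.
  pose proof (pair_le (vsub y z) (dsub ys zs)) as H1.
  pose proof (Rle_abs (pair (vsub y z) (dsub ys zs))) as H2.
  pairs_in H1. pairs_in H2.
  set (n := vnorm (vsub y z)) in *. set (m := dnorm (dsub ys zs)) in *.
  pose proof (pow2_ge_0 (n - m)). nra.
Qed.

(** * Convexity of Psi and conjugates of squared norms *)

Lemma norm_sq_convex {E : NormedSpace} : convex_fun (fun v : E => vnorm v ^ 2).
Proof.
  intros v w t Ht.
  pose proof (vnorm_triangle _ (vscal t v) (vscal (1 - t) w)) as H.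
  rewrite !vnorm_scal, !Rabs_right in H by lra.
  pose proof (vnorm_ge0 (vadd (vscal t v) (vscal (1 - t) w))) as H0.
  set (n := vnorm (vadd (vscal t v) (vscal (1 - t) w))) in *.
  set (p := vnorm v) in *. set (q := vnorm w) in *.
  assert (n ^ 2 <= (t * p + (1 - t) * q) ^ 2) by (apply pow_incr; lra).
  assert (0 <= t * (1 - t) * (p - q) ^ 2).
  { apply Rmult_le_pos; [nra | apply pow2_ge_0]. }
  nra.
Qed.

Lemma Fitz_epi_convex {X : NormedSpace} (A : SetOp X) y ys a y' ys' a' t :
  0 < t < 1 -> Fitz_epi A y ys a -> Fitz_epi A y' ys' a' ->
  Fitz_epi A (vadd (vscal t y) (vscal (1 - t) y')) (dadd (dscal t ys) (dscal (1 - t) ys'))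
    (t * a + (1 - t) * a').
Proof.
  intros Ht H H' v vs Hv. specialize (H v vs Hv). specialize (H' v vs Hv). pairs. nra.
Qed.

Lemma Conj_epi_convex {X : NormedSpace} (A : SetOp X) y ys a y' ys' a' t :
  0 < t < 1 -> Conj_epi A y ys a -> Conj_epi A y' ys' a' ->
  Conj_epi A (vadd (vscal t y) (vscal (1 - t) y')) (dadd (dscal t ys) (dscal (1 - t) ys'))
    (t * a + (1 - t) * a').
Proof.
  intros Ht H H' v vs c Hv. specialize (H v vs c Hv). specialize (H' v vs c Hv). pairs. nra.
Qed.

Lemma Psi_epi_convex {X : NormedSpace} (A : SetOp X) :
  convex_rel (fun w : prod_space X (dual_space X) => Psi_epi A (fst w) (snd w)).
Proof.
  intros [x xs] [x' xs'] r r' t Ht; simpl.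
  intros (y & z & ys & zs & a & b & Hy & Hys & Ha & Hb & Hr)
    (y' & z' & ys' & zs' & a' & b' & Hy' & Hys' & Ha' & Hb' & Hr').
  exists (vadd (vscal t y) (vscal (1 - t) y')), (vadd (vscal t z) (vscal (1 - t) z')),
    (dadd (dscal t ys) (dscal (1 - t) ys')), (dadd (dscal t zs) (dscal (1 - t) zs')),
    (t * a + (1 - t) * a'), (t * b + (1 - t) * b').
  split; [| split; [| split; [now apply Fitz_epi_convex | split; [now apply Conj_epi_convex |]]]].
  - apply vec_ext; intros f.
    pose proof (f_equal (fun v => pair v f) Hy) as E.
    pose proof (f_equal (fun v => pair v f) Hy') as E'.
    simpl in E, E'. pairs_in E. pairs_in E'. pairs.
    transitivity (t * (pair y f + pair z f) + (1 - t) * (pair y' f + pair z' f)); [ring |].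
    rewrite E, E'. ring.
  - apply dual_ext; intros v.
    pose proof (f_equal (fun f => pair v f) Hys) as E.
    pose proof (f_equal (fun f => pair v f) Hys') as E'.
    simpl in E, E'. pairs_in E. pairs_in E'. pairs.
    transitivity (t * (pair v ys + pair v zs) + (1 - t) * (pair v ys' + pair v zs')); [ring |].
    rewrite E, E'. ring.
  - pose proof (norm_sq_convex (vsub y z) (vsub y' z') t Ht) as H1.
    pose proof (norm_sq_convex (E := dual_space X) (dsub ys zs) (dsub ys' zs') t Ht) as H2.
    simpl in H1, H2.
    match goal with |- context [vnorm ?v ^ 2 + dnorm ?f ^ 2] =>
      replace v with (vadd (vscal t (vsub y z)) (vscal (1 - t) (vsub y' z'))) by vec;
      replace f with (dadd (dscal t (dsub ys zs)) (dscal (1 - t) (dsub ys' zs')))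
    end.
    + simpl pow. nra.
    + apply dual_ext; intros v. rewrite pair_dadd, !pair_dscal, !pair_dsub, !pair_dadd, !pair_dscal.
      ring.
Qed.

(** The conjugate of one eighth of the squared norm is twice the squared dual norm. Optimizing along
    each line through 0 bounds [|<x, f>|] by [sqrt (m / 2)] times the norm of [x]. *)
Lemma half_sq_conj_dual {X : NormedSpace} (f : Dual X) m :
  (forall x, pair x f - 1 / 8 * vnorm x ^ 2 <= m) -> 2 * dnorm f ^ 2 <= m.
Proof.
  intros H.
  assert (Hm : 0 <= m).
  { pose proof (H vzero) as H0. rewrite pair_zero, vnorm_zero in H0. lra. }
  assert (Hs : dnorm f <= sqrt (m / 2)).
  { apply dnorm_le; [apply sqrt_pos |]. intros x.
    rewrite <- (sqrt_pow2 (vnorm x)) by apply vnorm_ge0.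
    rewrite <- sqrt_mult; [| lra | apply pow2_ge_0].
    rewrite <- sqrt_Rsqr_abs. apply sqrt_le_1_alt. unfold Rsqr.
    destruct (Req_dec (vnorm x) 0) as [H0 | H0].
    { rewrite (vnorm_eq0 _ _ H0), pair_zero, vnorm_zero. lra. }
    pose proof (vnorm_ge0 x) as Hx.
    (* This scalar maximizes the quadratic [s <x, f> - s^2 |x|^2 / 8] in [s]. *)
    pose proof (H (vscal (4 * pair x f / vnorm x ^ 2) x)) as H1.
    rewrite pair_scal, vnorm_scal, Rpow_mult_distr, pow2_abs in H1.
    assert (H2 : 0 < vnorm x ^ 2) by (apply pow_lt; lra).
    apply (Rmult_le_compat_r (vnorm x ^ 2 / 2)) in H1; [| lra].
    replace (pair x f * pair x f) with
      ((4 * pair x f / vnorm x ^ 2 * pair x f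
        - 1 / 8 * ((4 * pair x f / vnorm x ^ 2) ^ 2 * vnorm x ^ 2)) * (vnorm x ^ 2 / 2))
      by (field; lra).
    lra. }
  pose proof (dnorm_ge0 f).
  assert (dnorm f ^ 2 <= sqrt (m / 2) ^ 2) as Hp by (apply pow_incr; lra).
  rewrite pow2_sqrt in Hp; lra.
Qed.

(** The same conjugate on the dual side, where the maximum is reached at [4 |a|] times a norming
    functional of [a]. *)
Lemma half_sq_conj {X : NormedSpace} (a : X) m :
  (forall f, pair a f - 1 / 8 * dnorm f ^ 2 <= m) -> 2 * vnorm a ^ 2 <= m.
Proof.
  intros H. destruct (norming_functional a) as (f & Hf & Hn).
  specialize (H (dscal (4 * vnorm a) f)). pose proof (vnorm_ge0 a). pose proof (dnorm_ge0 f).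
  rewrite pair_dscal, Hf, dnorm_scal, Rabs_right in H by lra.
  assert (dnorm f ^ 2 <= 1 ^ 2) by (apply pow_incr; lra).
  assert ((4 * vnorm a * dnorm f) ^ 2 <= 16 * vnorm a ^ 2).
  { rewrite !Rpow_mult_distr. pose proof (pow2_ge_0 (vnorm a)). nra. }
  nra.
Qed.

(* The half of autoconjugacy that is needed: Psi(u,us) <= Psi^*(us,u). Conjugating the
   proximal-average formula gives the pair [(u,us) + 2 (a,as)], [(u,us) - 2 (a,as)], where
   [(a,as)] is the slope of the affine function separating the quadratic term from the rest. *)
Lemma Psi_epi_of_affine_minorant {X : NormedSpace} (A : SetOp X) u us c v vs :
  reflexive X -> monotone_op A -> A v vs ->
  (forall x xs r, Psi_epi A x xs r -> pair x us + pair u xs + c <= r) ->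
  Psi_epi A u us (- c).
Proof.
  intros HX HA Hv Hmin.
  (* The midpoint is eliminated: [S] holds the non-quadratic part of Psi minus the linear part of
     the minorant, indexed by the difference [V], and [k] holds the quadratic part minus [c]. The
     hypothesis then says that [S] and [k] have nonnegative sum. *)
  set (S := fun (V : prod_space X (dual_space X)) s =>
    exists y z ys zs a b, V = (vsub y z, dsub ys zs) /\ Fitz_epi A y ys a /\ Conj_epi A z zs b /\
      a / 2 + b / 2 - (pair y us + pair z us + pair u ys + pair u zs) / 2 <= s).
  set (k := fun V : prod_space X (dual_space X) =>
    1 / 8 * (vnorm (fst V) ^ 2 + dnorm (snd V) ^ 2) - c).
  destruct (sandwich S k (vsub v v, dsub vs vs)
    (pair v vs / 2 + pair v vs / 2 - (pair v us + pair v us + pair u vs + pair u vs) / 2)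
    (1 - c) 1) as (L & HL & HLb & HLe).
  - intros V W r s t Ht (y & z & ys & zs & a & b & -> & Ha & Hb & Hr)
      (y' & z' & ys' & zs' & a' & b' & -> & Ha' & Hb' & Hr').
    exists (vadd (vscal t y) (vscal (1 - t) y')), (vadd (vscal t z) (vscal (1 - t) z')),
      (dadd (dscal t ys) (dscal (1 - t) ys')), (dadd (dscal t zs) (dscal (1 - t) zs')),
      (t * a + (1 - t) * a'), (t * b + (1 - t) * b').
    split; [| split; [now apply Fitz_epi_convex | split; [now apply Conj_epi_convex |]]].
    + simpl. f_equal; [vec |]. apply dual_ext; intros w.
      rewrite pair_dadd, !pair_dscal, !pair_dsub, !pair_dadd, !pair_dscal. ring.
    + pairs. nra.
  - intros V W t Ht. unfold k. simpl fst; simpl snd.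
    pose proof (norm_sq_convex (fst V) (fst W) t Ht) as H1.
    pose proof (norm_sq_convex (E := dual_space X) (snd V) (snd W) t Ht) as H2.
    cbv beta in H1, H2. simpl vnorm in *. simpl vadd in *. simpl vscal in *. lra.
  - intros V r (y & z & ys & zs & a & b & -> & Ha & Hb & Hr). unfold k; cbn [fst snd].
    enough (pair (vscal (1 / 2) (vadd y z)) us + pair u (dscal (1 / 2) (dadd ys zs)) + c
      <= a / 2 + b / 2 + 1 / 8 * (vnorm (vsub y z) ^ 2 + dnorm (dsub ys zs) ^ 2)) as H
      by (pairs_in H; lra).
    apply Hmin. exists y, z, ys, zs, a, b.
    split; [vec; field | split; [apply dual_ext; intros w; pairs; field |]].
    split; [exact Ha | split; [exact Hb | apply Rle_refl]].
  - exists v, v, vs, vs, (pair v vs), (pair v vs). split; [reflexivity |].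
    split; [now apply Fitz_epi_graph | split; [now apply Conj_epi_graph | apply Rle_refl]].
  - lra.
  - intros [w ws] Hw. unfold k. simpl in Hw |- *.
    replace (vadd (vsub v v) w) with w by vec.
    replace (dadd (dsub vs vs) ws) with ws by (apply dual_ext; intros x; pairs; ring).
    pose proof (vnorm_ge0 w). pose proof (dnorm_ge0 ws).
    assert (vnorm w ^ 2 <= 1 ^ 2) by (apply pow_incr; lra).
    assert (dnorm ws ^ 2 <= 1 ^ 2) by (apply pow_incr; lra). lra.
  - destruct (bounded_functional_on_product L HX HL HLb) as (a & b & Hab).
    (* Maximizing the sandwich inequality over its free point conjugates the two squared norms
       separately. *)
    assert (Hsq : forall V s, S V s -> 2 * (vnorm a ^ 2 + dnorm b ^ 2) + c <= s + L V).
    { intros V s HVs.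
      enough (2 * vnorm a ^ 2 <= s + L V - c - 2 * dnorm b ^ 2) by lra.
      apply half_sq_conj. intros f.
      enough (2 * dnorm b ^ 2 <= s + L V - c - (pair a f - 1 / 8 * dnorm f ^ 2)) by lra.
      apply half_sq_conj_dual. intros x.
      pose proof (HLe V s (x, f) HVs) as H. rewrite Hab in H. unfold k in H. simpl in H. lra. }
    set (p := vadd u (vscal 2 a)). set (ps := dadd us (dscal 2 b)).
    set (q := vsub u (vscal 2 a)). set (qs := dsub us (dscal 2 b)).
    set (N := vnorm a ^ 2 + dnorm b ^ 2) in *.
    (* Twice [Hsq], regrouped by point. Taking [z] in the graph, with [b = <z, zs>], suffices
       because the Fitzpatrick function at [(p, ps)] is a supremum over the graph. *)
    assert (Hkey : forall y ys a1 z zs, Fitz_epi A y ys a1 -> A z zs ->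
      pair y qs + pair q ys - a1 + (pair z ps + pair p zs - pair z zs) <= - 4 * N - 2 * c).
    { intros y ys a1 z zs Ha1 Hz.
      assert (HS : S (vsub y z, dsub ys zs) (a1 / 2 + pair z zs / 2
        - (pair y us + pair z us + pair u ys + pair u zs) / 2)).
      { exists y, z, ys, zs, a1, (pair z zs). split; [reflexivity |].
        split; [exact Ha1 | split; [now apply Conj_epi_graph | apply Rle_refl]]. }
      apply Hsq in HS. rewrite Hab in HS. pairs_in HS.
      unfold p, ps, q, qs. pairs. lra. }
    assert (Hlub := real_sup_lub (fun t => exists z zs, A z zs /\ t = pair p zs + pair z ps - pair z zs)
      (- 4 * N - 2 * c - (pair v qs + pair q vs - pair v vs))).
    destruct Hlub as [Hub Hl].
    { eexists. exists v, vs. split; [exact Hv | reflexivity]. }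
    { intros t (z & zs & Hz & ->).
      pose proof (Hkey _ _ _ _ _ (Fitz_epi_graph A v vs HA Hv) Hz). lra. }
    (* [al] is the Fitzpatrick function at [(p, ps)]. What [Hkey] leaves bounds the conjugate at
       [(qs, q)], and the quadratic term [2 N] cancels the [- 2 N] from half of their sum, leaving
       [- c]. *)
    match type of Hub with is_upper_bound _ ?s => set (al := s) in * end.
    exists p, q, ps, qs, al, (- 4 * N - 2 * c - al).
    split; [unfold p, q; vec | split; [apply dual_ext; intros w; unfold ps, qs; pairs; ring |]].
    split; [| split].
    + intros z zs Hz. apply Hub. now exists z, zs.
    + intros y ys a1 Ha1.
      enough (al <= - 4 * N - 2 * c - (pair y qs + pair q ys - a1)) by lra.
      apply Hl. intros t (z & zs & Hz & ->). pose proof (Hkey _ _ _ _ _ Ha1 Hz). lra.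
    + replace (vsub p q) with (vscal 4 a) by (unfold p, q; vec).
      replace (dsub ps qs) with (dscal 4 b)
        by (apply dual_ext; intros w; unfold ps, qs; pairs; ring).
      rewrite vnorm_scal, dnorm_scal, !Rabs_right by lra.
      unfold N. apply Req_le. field.
Qed.

(** At the midpoint, Psi is at least the pairing and at most the mean of the two end values; these
    differ by a quarter of [<x - y, xs - ys>], up to the error. *)
Lemma Psi_graph_monotone {X : NormedSpace} (A : SetOp X) :
  monotone_op (fun x xs => forall e, 0 < e -> Psi_epi A x xs (pair x xs + e)).
Proof.
  intros x xs y ys Hx Hy. apply le_epsilon. intros e He.
  assert (Ht : 0 < / 2 < 1) by lra.
  pose proof (Psi_epi_convex A (x, xs) (y, ys) _ _ (/ 2) Ht
    (Hx (e / 4) ltac:(lra)) (Hy (e / 4) ltac:(lra))) as H.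
  simpl in H. apply Psi_epi_pair in H. pairs_in H. pairs. lra.
Qed.

(** * Surjectivity of the perturbed operator *)

Lemma Psi_graph_plus_F_surjective (X : NormedSpace) (F : X -> Dual X) (A : SetOp X) v vs w :
  complete X -> reflexive X -> standing_assumption F -> monotone_op A -> A v vs ->
  exists u us, Psi_epi A u us (pair u us) /\ w = dadd us (F u).
Proof.
  intros HXc HX (Fmon & Fmax & _ & F3 & _) HA Hv.
  set (E := prod_space X (dual_space X)).
  (* The supremum [k] of these affine functions is [Phi_F (x, w - xs) - <x, w>]. *)
  set (l := fun (y : X) (V : E) => pair (fst V) (F y) + pair y (dsub w (snd V))
    - pair y (F y) - pair (fst V) w).
  set (k := fun V => real_sup (fun r => exists y, r = l y V)).
  assert (Hk : forall V, is_lub (fun r => exists y, r = l y V) (k V)).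
  { intros [x xs]. destruct (F3 x (dsub w xs)) as [M HM].
    apply (real_sup_lub _ (M - pair x xs)).
    - exists (l vzero (x, xs)). now exists vzero.
    - intros r (y & ->). unfold l; simpl. specialize (HM y). pairs_in HM. pairs. lra. }
  assert (Hlk : forall y V, l y V <= k V) by (intros y V; apply (Hk V); now exists y).
  assert (Hkl : forall V b, (forall y, l y V <= b) -> k V <= b).
  { intros V b Hb. apply (Hk V). intros r (y & ->). apply Hb. }
  assert (Hconv : convex_fun k).
  { intros V W t Ht. apply Hkl. intros y. pose proof (Hlk y V). pose proof (Hlk y W).
    replace (l y (vadd (vscal t V) (vscal (1 - t) W))) with (t * l y V + (1 - t) * l y W); [nra |].
    unfold l; simpl. pairs. ring. }
  (* Otherwise [(x, w - xs)] would be strictly monotonically related to every point of the graph of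
     [F]; maximality puts it in that graph, and [y = x] is a contradiction. *)
  assert (Hpos : forall V r, Psi_epi A (fst V) (snd V) r -> 0 <= r + k V).
  { intros [x xs] r Hr; simpl in Hr. apply Psi_epi_pair in Hr.
    apply Rnot_lt_le; intros Hlt.
    assert (Hall : forall y, l y (x, xs) < - pair x xs).
    { intros y. pose proof (Hlk y (x, xs)). lra. }
    assert (HF : dsub w xs = F x).
    { apply Fmax. intros y. specialize (Hall y). unfold l in Hall; simpl in Hall.
      pairs_in Hall. pairs. lra. }
    specialize (Hall x). unfold l in Hall; cbn [fst snd] in Hall. rewrite HF in Hall.
    apply (f_equal (fun f => pair x f)) in HF. pairs_in HF. lra. }
  destruct (locally_bounded_of_pointwise X l k) as (c & d & M & Hd & HM).
  { apply prod_complete; [exact HXc | apply dual_complete]. }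
  { intros y. exists (dnorm (F y) + vnorm y + dnorm w). intros [x xs] [x' xs'].
    replace (l y (x, xs) - l y (x', xs'))
      with (pair (vsub x x') (dsub (F y) w) - pair y (dsub xs xs')).
    - change (@vnorm E (@vsub E (x, xs) (x', xs')))
        with (vnorm (vsub x x') + dnorm (dsub xs xs')).
      pose proof (pair_le (vsub x x') (F y)) as H1. pose proof (pair_le (vsub x x') w) as H2.
      pose proof (pair_le y (dsub xs xs')) as H3.
      pose proof (vnorm_ge0 (vsub x x')). pose proof (dnorm_ge0 (dsub xs xs')).
      pose proof (vnorm_ge0 y). pose proof (dnorm_ge0 (F y)). pose proof (dnorm_ge0 w).
      rewrite pair_dsub. unfold Rminus. rewrite <- Rabs_Ropp in H2, H3.
      eapply Rle_trans; [apply Rabs_triang |].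
      pose proof (Rabs_triang (pair (vsub x x') (F y)) (- pair (vsub x x') w)). nra.
    - unfold l; simpl. pairs. ring. }
  { exact Hlk. }
  set (V0 := (v, vs) : E).
  (* The bound for [k] near [c] is moved to [V0]: [V0 + W] is the midpoint of [c + 2 W] and
     [2 V0 - c], so the radius is halved and convexity gives the constant. *)
  destruct (sandwich (fun V : E => Psi_epi A (fst V) (snd V)) k V0 (pair v vs)
    (/ 2 * M + (1 - / 2) * k (vsub (vscal 2 V0) c)) (d / 2)) as (L & HL & HLb & HLe).
  - apply Psi_epi_convex.
  - exact Hconv.
  - exact Hpos.
  - now apply Psi_epi_graph.
  - lra.
  - intros W HW.
    replace (vadd V0 W) with
      (vadd (vscal (/ 2) (vadd c (vscal 2 W))) (vscal (1 - / 2) (vsub (vscal 2 V0) c)))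
      by (vec; field).
    eapply Rle_trans; [apply Hconv; lra |]. apply Rplus_le_compat_r, Rmult_le_compat_l; [lra |].
    apply Hkl. intros y. apply HM.
    replace (vsub (vadd c (vscal 2 W)) c) with (vscal 2 W) by vec.
    rewrite vnorm_scal, Rabs_right; lra.
  - destruct (bounded_functional_on_product L HX HL HLb) as (b & bs & Hb).
    set (u := vopp b). set (us := dscal (-1) bs).
    (* The sandwich is read at [(y, w - F y)], where monotonicity of [F] gives
       [k <= <y, F y> - <y, w>]. This yields an affine minorant of Psi for each [y], all with the
       same slope. *)
    assert (HG : forall y,
      Psi_epi A u us (pair y us + pair u w - pair u (F y) + pair y (F y) - pair y w)).
    { intros y. apply (Psi_epi_mono _ _ _ (- (L (y, dsub w (F y)) - k (y, dsub w (F y))))).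
      - assert (k (y, dsub w (F y)) <= pair y (F y) - pair y w).
        { apply Hkl. intros z. unfold l; simpl. pose proof (Fmon y z) as H.
          pairs_in H. pairs. lra. }
        rewrite Hb. unfold u, us. pairs. lra.
      - apply (Psi_epi_of_affine_minorant A u us _ v vs HX HA Hv). intros x xs r Hr.
        assert (H : L (y, dsub w (F y)) - L (x, xs) <= r + k (y, dsub w (F y)))
          by exact (HLe (x, xs) r (y, dsub w (F y)) Hr).
        replace (L (x, xs)) with (pair x bs + pair b xs) in H by exact (eq_sym (Hb x xs)).
        unfold u, us. pairs. lra. }
    (* With Psi above the pairing, [HG] becomes [0 <= <u - y, (w - us) - F y>]. Once this equality
       holds, [HG u] reads Psi [<= <u, us>]. *)
    assert (HFu : dsub w us = F u).
    { apply Fmax. intros y. pose proof (Psi_epi_pair _ _ _ _ (HG y)). pairs. lra. }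
    exists u, us. split.
    + apply (Psi_epi_mono _ _ _ _ _) with (2 := HG u). lra.
    + rewrite <- HFu. apply dual_ext; intros x. pairs. ring.
Qed.

(** * The extended map *)

Theorem theorem8p1 (X : NormedSpace) (HXc : complete X) (HXr : reflexive X)
  (F : X -> Dual X) (HF : standing_assumption F)
  (C : X -> Prop) (HC : exists c, C c) (T : X -> X)
  (HT : F_firmly_nonexpansive F C T) :
  exists Tt : X -> X,
    (forall x y, Ttilde_rel F C T x y <-> y = Tt x) /\
    F_firmly_nonexpansive F (fun _ => True) Tt /\
    (forall x, C x -> Tt x = T x).
Proof.
  set (A := op_A F C T).
  (* Firm nonexpansiveness of [T] is monotonicity of [A] written at the points [T x] and [T x']. *)
  assert (HA : monotone_op A).
  { intros y ys y' ys' (x & Hx & <- & ->) (x' & Hx' & <- & ->).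
    pose proof (HT x x' Hx Hx') as H. pairs_in H. pairs. lra. }
  assert (Hgraph : forall x, C x -> A (T x) (dsub (F x) (F (T x))))
    by (intros x Hx; now exists x).
  destruct HC as [c Hc]. pose proof (Hgraph c Hc) as Hne.
  (* The lower-bound half of [Psi_eq_Fin] always holds at the value [<x, xs>], so only approximation
     remains. *)
  assert (Hat : forall x xs, op_Atilde F C T x xs <->
    forall e, 0 < e -> Psi_epi A x xs (pair x xs + e)).
  { intros x xs. unfold op_Atilde. fold A. rewrite (Psi_eq_Fin A _ _ _ _ _ HA Hne).
    split; [tauto | split; [apply Psi_epi_pair | assumption]]. }
  assert (Hof : forall x xs, Psi_epi A x xs (pair x xs) -> op_Atilde F C T x xs).
  { intros x xs H. apply Hat. intros e He. apply (Psi_epi_mono _ _ _ (pair x xs)); [lra | exact H]. }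
  assert (Hmon : forall x y x' y', Ttilde_rel F C T x y -> Ttilde_rel F C T x' y' ->
    pair (vsub y y') (dsub (F y) (F y')) <= pair (vsub y y') (dsub (F x) (F x'))).
  { intros x y x' y' (a & Ha & E) (a' & Ha' & E').
    pose proof (Psi_graph_monotone A _ _ _ _ (proj1 (Hat _ _) Ha) (proj1 (Hat _ _) Ha')) as H. rewrite E, E'.
    pairs_in H. pairs. lra. }
  assert (Huniq : forall x y y', Ttilde_rel F C T x y -> Ttilde_rel F C T x y' -> y = y').
  (* For equal arguments the right side of [Hmon] is 0, against strict monotonicity of [F]. *)
  { intros x y y' Hy Hy'. apply NNPP; intros Hn.
    pose proof (Hmon _ _ _ _ Hy Hy') as H. destruct HF as (_ & _ & Hstrict & _).
    pose proof (Hstrict _ _ Hn) as H1. pairs_in H. pairs_in H1. lra. }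
  assert (Hex : forall x, exists y, Ttilde_rel F C T x y).
  { intros x. destruct (Psi_graph_plus_F_surjective X F A _ _ (F x) HXc HXr HF HA Hne)
      as (u & us & Hu & E).
    exists u, us. split; [now apply Hof | exact E]. }
  set (Tt := fun x => proj1_sig (constructive_indefinite_description _ (Hex x))).
  assert (HTt : forall x, Ttilde_rel F C T x (Tt x)).
  { intros x. unfold Tt. now destruct constructive_indefinite_description. }
  exists Tt. split; [| split].
  - intros x y. split; [intros H; exact (Huniq _ _ _ H (HTt x)) | intros ->; apply HTt].
  - intros x y _ _. apply Hmon; apply HTt.
  (* The graph of [A] lies in that of its extension, so [T x] solves the inclusion defining [Tt x],
     and uniqueness applies. *)
  - intros x Hx. apply (Huniq x _ _ (HTt x)). exists (dsub (F x) (F (T x))). split.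
    + apply Hof, Psi_epi_graph; auto.
    + apply dual_ext; intros y. pairs. ring.
Qed.
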